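(* Let $(\mathsf{U},\mathsf{D},\mathsf{H})$ be a triplet of Kerov's operators on $\mathbb{G}=(J(P),\kappa)$ with $\kappa$ UD-self-dual, and assume $\mathsf{t}=(\mathsf{H}e_\varnothing,e_\varnothing)\in\mathbb{C}\setminus\{0,-1,-2,\dots\}$. For $n\ge0$ and $\lambda\in\mathbb{G}_n$ set $$M_n(\lambda)=\frac{(\mathsf{U}^ne_\varnothing,e_\lambda)(\mathsf{D}^ne_\lambda,e_\varnothing)}{n!(\mathsf{t})_n}=\frac{(\dim\lambda)^2}{n!(\mathsf{t})_n}\prod_{\square\in\lambda}\mathsf{q}(\square)^2 .$$ Then $\{M_n\}_{n\ge0}$ is a (possibly complex-valued) coherent system: $\sum_{\lambda\in\mathbb{G}_n}M_n(\lambda)=1$ for every $n$, and $$\sum_{\nu\searrow\lambda}M_{n+1}(\nu)\,\frac{\kappa(\lambda,\nu)\dim\lambda}{\dim\nu}=M_n(\lambda)\qquad\text{for all }n\ge0,\ \lambda\in\mathbb{G}_n.$$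
   Context: $P$ is a poset in which every element lies in some finite order ideal; $\mathbb{G}=J(P)$ is the set of finite order ideals, $|\lambda|$ its cardinality, $\mathbb{G}_n=\{|\lambda|=n\}$ assumed finite, and every ideal is contained in one with one more element. $\mu\nearrow\lambda$ (or $\lambda\searrow\mu$) means $\mu\subset\lambda$, $|\lambda|=|\mu|+1$; $\lambda/\mu$ is the element of $\lambda\setminus\mu$. $\kappa(\mu,\lambda)>0$ is given for each $\mu\nearrow\lambda$; $\kappa$ is UD-self-dual if $\kappa(\mu,\lambda)\kappa(\mu,\rho)=\kappa(\lambda,\nu)\kappa(\rho,\nu)$ whenever $\mu\nearrow\lambda\nearrow\nu$, $\mu\nearrow\rho\nearrow\nu$, $\rho\ne\lambda$. $\dim\lambda$ is the sum over all chains $\varnothing=\lambda^{(0)}\nearrow\lambda^{(1)}\nearrow\cdots\nearrow\lambda^{(n)}=\lambda$ of $\prod_i\kappa(\lambda^{(i)},\lambda^{(i+1)})$. On $\ell^2_{\mathrm{fin}}(\mathbb{G})$ (finitely supported complex functions, basis $e_\lambda$ of indicators, inner product $(f,g)=\sum f\bar g$), a triplet of Kerov's operators is $(\mathsf{U},\mathsf{D},\mathsf{H})$ with $\mathsf{U}e_\lambda=\sum_{\nu\searrow\lambda}\kappa(\lambda,\nu)\mathsf{q}(\nu/\lambda)e_\nu$, $\mathsf{D}e_\lambda=\sum_{\mu\nearrow\lambda}\kappa(\mu,\lambda)\mathsf{q}(\lambda/\mu)e_\mu$ for some complex function $\mathsf{q}$ on $P$, and $\mathsf{H}$ a linear operator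 having each $e_\lambda$ as eigenvector with eigenvalue depending only on $|\lambda|$, with $[\mathsf{H},\mathsf{U}]=2\mathsf{U}$, $[\mathsf{H},\mathsf{D}]=-2\mathsf{D}$, $[\mathsf{D},\mathsf{U}]=\mathsf{H}$. $(a)_n=a(a+1)\cdots(a+n-1)$. *)

(* Defs.v *)
From HB Require Import structures.
From mathcomp Require Import all_boot all_order all_algebra finmap.
From mathcomp Require Import complex monalg.
From mathcomp Require Import boolp classical_sets functions cardinality fsbigop reals.

Set Implicit Arguments.
Unset Strict Implicit.
Unset Printing Implicit Defensive.

Import Order.TTheory GRing.Theory Num.Theory.
Local Open Scope fset_scope.
Local Open Scope classical_set_scope.
Local Open Scope complex_scope.
Local Open Scope ring_scope.

Section Ideals.
Context {d : Order.disp_t} (P : porderType d).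

Definition is_ideal (l : {fset P}) : bool :=
  `[< forall x y : P, (y <= x)%O -> x \in l -> y \in l >].

Record ideal : Type := Ideal { ideal_fset :> {fset P}; idealP : is_ideal ideal_fset }.

HB.instance Definition _ := [isSub for ideal_fset].
HB.instance Definition _ := [Choice of ideal by <:].

Lemma fset0_ideal : is_ideal fset0.
Proof. by apply/asboolP => x y _; rewrite in_fset0. Qed.

Definition ideal0 : ideal := Ideal fset0_ideal.

Definition level (n : nat) : set ideal := [set l : ideal | #|` l | = n].

Definition covers : rel ideal :=
  fun mu lam => (mu `<=` lam)%fset && (#|` lam | == #|` mu |.+1).

(* [skew_box mu lam] is [Some x] with x the element of lam \ mu when mu is covered
   by lam; the value is irrelevant for other pairs. *)
Definition skew_box (mu lam : ideal) : option P := ohead (enum_fset (lam `\` mu)%fset).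

(* Chains from the empty ideal to lam, the initial empty ideal being omitted
   from the sequence. *)
Definition chains (lam : ideal) : set (seq ideal) :=
  [set c | path covers ideal0 c /\ last ideal0 c = lam].

End Ideals.

Arguments ideal0 {d P}.
Arguments level {d} P n.

Section Kerov.
Context {R : realType} {d : Order.disp_t} {P : porderType d}.
Local Notation G := (ideal P).
Local Notation C := (R[i]).

(* Multiplicity functions are total; only their values at pairs with
   [covers mu lam] are ever used. *)
Implicit Types (kappa : G -> G -> R) (q : P -> C).

Definition positive_multiplicity kappa : Prop :=
  forall mu lam, covers mu lam -> 0 < kappa mu lam.

Definition UD_self_dual kappa : Prop :=
  forall mu lam rho nu : G,
    covers mu lam -> covers lam nu -> covers mu rho -> covers rho nu ->
    rho <> lam ->
    kappa mu lam * kappa mu rho = kappa lam nu * kappa rho nu.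

Definition wdim kappa (lam : G) : R :=
  \sum_(c \in chains lam) \prod_(w <- pairmap kappa ideal0 c) w.

(* {malg C[G]} is the space of finitely supported functions G -> C. Only its
   vector space structure is used: f@_lam is the value of f at lam and
   << lam >> is the indicator function of lam. *)
Definition ell2fin : lmodType C := {malg C[G]}.

Definition evec (lam : G) : ell2fin := << lam >>.

Definition inner (f g : ell2fin) : C :=
  \sum_(lam <- msupp f) f@_lam * (g@_lam)^*.

Definition qskew q (mu lam : G) : C := oapp q 0 (skew_box mu lam).

Definition commutator (A B : {linear ell2fin -> ell2fin}) (f : ell2fin) : ell2fin :=
  A (B f) - B (A f).

Record kerov_triplet kappa q (U D H : {linear ell2fin -> ell2fin}) : Prop :=
  KerovTriplet {
    kerovU : forall lam : G, U (evec lam) =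
      \sum_(nu \in [set nu | covers lam nu])
        ((kappa lam nu)%:C * qskew q lam nu) *: evec nu;
    kerovD : forall lam : G, D (evec lam) =
      \sum_(mu \in [set mu | covers mu lam])
        ((kappa mu lam)%:C * qskew q mu lam) *: evec mu;
    kerovH : exists h : nat -> C,
      forall lam : G, H (evec lam) = h #|` lam | *: evec lam;
    kerovHU : forall f, commutator H U f = 2 *: U f;
    kerovHD : forall f, commutator H D f = - 2 *: D f;
    kerovDU : forall f, commutator D U f = H f
  }.

Definition rising (a : C) (n : nat) : C := \prod_(i < n) (a + i%:R).

Definition kerov_param (H : {linear ell2fin -> ell2fin}) : C :=
  inner (H (evec ideal0)) (evec ideal0).

Definition kerov_measure (U D H : {linear ell2fin -> ell2fin})
    (n : nat) (lam : G) : C :=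
  inner (iter n U (evec ideal0)) (evec lam)
  * inner (iter n D (evec lam)) (evec ideal0)
  / (n`!%:R * rising (kerov_param H) n).

Definition coherent_system kappa (M : nat -> G -> C) : Prop :=
  (forall n : nat, \sum_(lam \in level P n) M n lam = 1) /\
  (forall (n : nat) (lam : G), level P n lam ->
     \sum_(nu \in [set nu | covers lam nu])
       M n.+1 nu * (kappa lam nu * wdim kappa lam / wdim kappa nu)%:C
     = M n lam).

End Kerov.

Arguments ell2fin R {d} P.

(* Main.v *)
(* Put w(l) = dim l * prod_{x in l} q x.  The recursion for dim over the ideals
   covered by l says that w(l) is both the coefficient of e_l in U^n e_0 and
   that of e_0 in D^n e_l, so M_n(l) = w(l)^2 / (n! (t)_n).
   The sl2 relations give D U^n e_0 = n (t + n - 1) U^(n-1) e_0.  Iterating and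
   reading off the coefficient of e_0 in D^n U^n e_0 = n! (t)_n e_0 gives total
   mass 1; reading off the coefficient of e_l in D U^(n+1) e_0 gives coherence. *)
Require Import Defs.
From mathcomp Require Import all_boot all_order all_algebra finmap.
From mathcomp Require Import complex monalg.
From mathcomp Require Import boolp classical_sets functions cardinality fsbigop reals.
From mathcomp Require Import ring.

Set Implicit Arguments.
Unset Strict Implicit.
Unset Printing Implicit Defensive.

Import Order.TTheory GRing.Theory Num.Theory.
Local Open Scope classical_set_scope.
Local Open Scope complex_scope.
Local Open Scope ring_scope.

(** * Covering relations, levels and saturated chains of ideals *)

Section Ideals.
Context {d : Order.disp_t} {P : porderType d}.
Implicit Types mu lam nu : ideal P.

Lemma ideal_inj lam mu : lam = mu :> {fset P} -> lam = mu.
Proof. exact: val_inj. Qed.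

Lemma level0 : level P 0 = [set ideal0].
Proof.
apply/seteqP; split => lam; rewrite /level /=.
  by move/eqP; rewrite cardfs_eq0 => /eqP e; apply: ideal_inj.
by move=> ->; rewrite cardfs0.
Qed.

Lemma covers_level n mu lam : covers mu lam -> level P n.+1 lam -> level P n mu.
Proof. by rewrite /level /= => /andP[_ /eqP ->] []. Qed.

Lemma level_covers n mu lam : covers mu lam -> level P n mu -> level P n.+1 lam.
Proof. by rewrite /level /= => /andP[_ /eqP ->] ->. Qed.

Lemma finite_covers (finite_level : forall n, finite_set (level P n)) lam :
  finite_set [set nu | covers lam nu].
Proof.
apply: sub_finite_set (finite_level #|` lam |.+1) => nu /= cov.
exact: level_covers cov _.
Qed.

Lemma finite_covered (finite_level : forall n, finite_set (level P n)) lam :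
  finite_set [set mu | covers mu lam].
Proof.
apply: sub_finite_set (finite_level #|` lam |.-1) => mu /= cov.
by rewrite /level /=; case/andP: cov => _ /eqP ->.
Qed.

(** The difference of the two ideals has cardinality one, so its enumeration is a one-entry list and
    [ohead] returns that entry. *)
Lemma skew_boxP mu lam : covers mu lam ->
  exists x, [/\ skew_box mu lam = Some x, x \notin (mu : {fset P})
              & lam = x |` mu :> {fset P}]%fset.
Proof.
case/andP=> sub /eqP card.
have /cardfs1P[x e] : (#|` lam `\` mu | == 1)%fset.
  by rewrite cardfsDS // card subSnn.
exists x; split.
- rewrite /skew_box e.
  have mem y : (y \in enum_fset [fset x]%fset) = (y == x) by exact: in_fset1.
  case E : (enum_fset _) mem => [|y s] mem; first by have := mem x; rewrite eqxx.
  by have := mem y; rewrite mem_head => /esym/eqP ->.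
- have : x \in (lam `\` mu)%fset by rewrite e in_fset1.
  by rewrite in_fsetD => /andP[].
- apply/fsetP => y; rewrite -e in_fsetU in_fsetD.
  by have [/(fsubsetP sub) -> |] := boolP (y \in (mu : {fset P})); rewrite ?orbF.
Qed.

Lemma chains0 : chains (ideal0 : ideal P) = [set [::]].
Proof.
apply/seteqP; split => c; last by move=> ->.
case/lastP: c => // c nu [] /[swap]; rewrite last_rcons => ->.
by rewrite rcons_path => /andP[_ /andP[_]]; rewrite cardfs0.
Qed.

Lemma chains_rcons lam nu (c : seq (ideal P)) :
  covers lam nu -> chains lam c -> chains nu (rcons c nu).
Proof.
by move=> cov [p e]; split; rewrite ?last_rcons // rcons_path p e.
Qed.

Lemma chains_rconsP nu (c : seq (ideal P)) : chains nu (rcons c nu) ->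
  chains (last ideal0 c) c /\ covers (last ideal0 c) nu.
Proof. by move=> [+ _]; rewrite rcons_path => /andP[]. Qed.

Lemma chains_level n nu (c : seq (ideal P)) : level P n.+1 nu -> chains nu c ->
  exists2 c', c = rcons c' nu & chains nu (rcons c' nu).
Proof.
move=> lnu; case/lastP: c => [[_ /= e]|c x [p]].
  by move: lnu; rewrite -e /level /mkset cardfs0.
rewrite last_rcons => e; exists c; first by rewrite e.
by split; rewrite -e // last_rcons.
Qed.

(** Strong induction on the cardinality: dropping the last entry of a chain leaves a chain to an
    ideal one level below, and that level is finite. *)
Lemma finite_chains (finite_level : forall n, finite_set (level P n)) lam :
  finite_set (chains lam).
Proof.
have [n] := ubnP #|` lam |; elim: n lam => // n IH lam.
case E : #|` lam | => [|m] ltmn.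
  have : level P 0 lam by [].
  by rewrite level0 => /= ->; rewrite chains0; exact: finite_set1.
have lm : level P m.+1 lam by [].
pose S := \bigcup_(mu in level P m) chains mu.
have finS : finite_set S.
  by apply: bigcup_finite => // mu /= lmu; apply: IH; rewrite lmu.
apply: sub_finite_set (finite_image (fun c => rcons c lam) finS) => c cc.
have [c' -> /chains_rconsP[cc' cov]] := chains_level lm cc.
by exists c' => //; exists (last ideal0 c') => //; apply: covers_level cov lm.
Qed.

End Ideals.

(** * Path recursions for the weighted dimension and for the weights [w] *)

Section Weights.
Context {R : realType} {d : Order.disp_t} {P : porderType d}.
Variables (kappa : ideal P -> ideal P -> R) (q : P -> R[i]).
Hypothesis finite_level : forall n, finite_set (level P n).
Implicit Types mu lam nu : ideal P.

Definition chain_weight (c : seq (ideal P)) : R :=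
  \prod_(w <- pairmap kappa ideal0 c) w.

Lemma chain_weight_rcons c nu :
  chain_weight (rcons c nu) = chain_weight c * kappa (last ideal0 c) nu.
Proof.
rewrite /chain_weight.
elim: c ideal0 => [|x c IH] y /=; first by rewrite big_seq1 big_nil mul1r.
by rewrite !big_cons IH mulrA.
Qed.

Lemma wdim0 : wdim kappa ideal0 = 1.
Proof. by rewrite /wdim chains0 fsbig_set1 big_nil. Qed.

(** Chains to [nu] are grouped by their penultimate ideal. The sum runs over a whole level, with
    zeros off the covering relation, so that its index set is independent of [nu] and sums can be
    exchanged. *)
Lemma wdim_rec n nu : level P n.+1 nu ->
  wdim kappa nu = \sum_(lam \in level P n)
    (if covers lam nu then wdim kappa lam * kappa lam nu else 0).
Proof.
move=> lnu; pose C := [set c | chains nu (rcons c nu)].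
have inj : injective (fun c => rcons c nu).
  exact: rcons_injl.
have imC : chains nu = (fun c => rcons c nu) @` C.
  apply/seteqP; split=> [c cc|_ [c cC <-] //].
  by have [c' -> cc'] := chains_level lnu cc; exists c'.
have finC : finite_set C.
  (* [belast] drops the final [nu] but puts [ideal0] in front; [behead] removes it again. *)
  have finI := finite_image (behead \o belast ideal0) (finite_chains finite_level nu).
  by apply: sub_finite_set finI => c cC; exists (rcons c nu) => //=; rewrite belast_rcons.
(* For a fixed [c] only its endpoint contributes to the inner sum, so the double sum is the sum of
   the chain weights. *)
transitivity (\sum_(c \in C) \sum_(lam \in level P n)
   (if `[< chains lam c >] then chain_weight c * kappa lam nu else 0)).
  rewrite /wdim imC fsbig_image; last by move=> x y _ _ /inj.
  apply: eq_fsbigr => c /[!inE] /chains_rconsP[cc cov].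
  rewrite -/(chain_weight _) chain_weight_rcons.
  rewrite -(fsbig_widen [set last ideal0 c]).
  - by rewrite fsbig_set1 asboolT.
  - move=> lam /= ->; exact: covers_level cov lnu.
  - by move=> lam [_ /= ne]; case: asboolP => // -[_ e]; case: ne.
rewrite exchange_fsbig //; apply: eq_fsbigr => lam _.
case: ifP => [cov|/negP ncov].
  rewrite /wdim mulr_fsuml; apply/esym.
  rewrite -(fsbig_widen (chains lam) C).
  - by apply: eq_fsbigr => c /[!inE] cc; rewrite asboolT.
  - by move=> c; exact: chains_rcons.
  - by move=> c [_ /= cc]; rewrite asboolF.
apply: fsbig1 => c /chains_rconsP[_ cov]; case: asboolP => // -[_ e].
by rewrite e in cov.
Qed.

Definition weight lam : R[i] :=
  (wdim kappa lam)%:C * \prod_(x <- (lam : {fset P})) q x.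

(** The matrix entry shared by [U] (from [lam] to [nu]) and [D] (from [nu] to [lam]), extended by
    zero to all pairs. *)
Definition edge lam nu : R[i] :=
  if covers lam nu then (kappa lam nu)%:C * qskew q lam nu else 0.

Lemma weight0 : weight ideal0 = 1.
Proof. by rewrite /weight wdim0 big_seq_fset0 mulr1. Qed.

Lemma prod_covers lam nu : covers lam nu ->
  \prod_(x <- (nu : {fset P})) q x
  = \prod_(x <- (lam : {fset P})) q x * qskew q lam nu.
Proof.
move=> /skew_boxP[x [sk xlam ->]].
by rewrite big_fsetU1 //= mulrC /qskew sk.
Qed.

Lemma weight_rec n nu : level P n.+1 nu ->
  weight nu = \sum_(lam \in level P n) weight lam * edge lam nu.
Proof.
move=> lnu; rewrite /weight (wdim_rec lnu) !fsbig_finite // rmorph_sum mulr_suml.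
apply: eq_bigr => lam _; rewrite /edge.
case: ifP => [cov|_]; last by rewrite raddf0 mul0r mulr0.
by rewrite (prod_covers cov) rmorphM /=; ring.
Qed.

End Weights.

(** * Coefficients of finitely supported functions and of their images under linear maps *)

Section FiniteSupport.
Context {R : realType} {d : Order.disp_t} {P : porderType d}.
Implicit Types (f : ell2fin R P) (lam : ideal P) (D : set (ideal P)).

Lemma mcoeff_evec lam mu : (evec lam : ell2fin R P)@_mu = (lam == mu)%:R.
Proof. exact: mcoeffU. Qed.

Lemma mcoeffZ_evec (c : R[i]) lam mu :
  (c *: evec lam : ell2fin R P)@_mu = c *+ (lam == mu).
Proof. by rewrite mcoeffZ mcoeff_evec mulr_natr. Qed.

Lemma inner_evec f lam : inner f (evec lam) = f@_lam.
Proof.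
rewrite /inner; under eq_bigr do rewrite mcoeff_evec rmorph_nat.
have [lf|lf] := boolP (lam \in msupp f).
  rewrite (bigD1_seq lam) ?fset_uniq //= eqxx mulr1 big1 ?addr0 // => mu ne.
  by rewrite eq_sym (negPf ne) mulr0.
rewrite big1_seq ?mcoeff_outdom // => mu /= muf.
by case: eqVneq lf muf => [-> /negPf ->|]; rewrite ?mulr0.
Qed.

(** Expand [f] over its support and use linearity. The free choice of [D] lets the sum be taken over
    a level instead of the support. *)
Lemma mcoeff_linear (A : {linear ell2fin R P -> ell2fin R P}) f lam D :
  (forall mu, ~ D mu -> f@_mu * (A (evec mu))@_lam = 0) ->
  (A f)@_lam = \sum_(mu \in D) f@_mu * (A (evec mu))@_lam.
Proof.
move=> D0; rewrite (fsbig_widen D setT) //; last by move=> mu [_ /D0].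
rewrite (fsbigTE (msupp f)); last by move=> mu /mcoeff_outdom ->; rewrite mul0r.
have {1}-> : f = \sum_(mu <- msupp f) f@_mu *: evec mu.
  rewrite {1}[f]monalgE; apply: eq_bigr => mu _; apply/malgP => nu.
  by rewrite mcoeffZ_evec; exact: mcoeffU.
rewrite linear_sum raddf_sum; apply: eq_bigr => mu _.
rewrite linearZ_LR /=; exact: mcoeffZ.
Qed.

Lemma mcoeff_fsum_evec D (c : ideal P -> R[i]) lam : finite_set D ->
  (\sum_(mu \in D) c mu *: (evec mu : ell2fin R P))@_lam
  = if lam \in D then c lam else 0.
Proof.
move=> finD; rewrite fsbig_finite // raddf_sum.
under eq_bigr do rewrite /= mcoeffZ_evec -mulr_natr.
case: ifPn => lD.
  rewrite (bigD1_seq lam) ?fset_uniq ?in_fset_set //= eqxx mulr1.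
  by rewrite big1 ?addr0 // => mu /negPf ->; rewrite mulr0.
rewrite big1_seq // => mu /=; rewrite in_fset_set // => muD.
by case: eqVneq lD muD => [-> /negPf ->|]; rewrite ?mulr0.
Qed.

End FiniteSupport.

(** * The sl2 action on the vectors generated from a lowest weight vector *)

Section LowestWeightVector.
Context {K : comNzRingType} {V : lmodType K} {U D H : {linear V -> V}}.
Hypothesis HU : forall v, H (U v) - U (H v) = 2 *: U v.
Hypothesis DU : forall v, D (U v) - U (D v) = H v.
Context {v0 : V} {t : K}.
Hypotheses (Hv0 : H v0 = t *: v0) (Dv0 : D v0 = 0).

(** Since H U = U H + 2 U, each application of [U] raises the eigenvalue of [H] by 2. *)
Lemma weight_iter n : H (iter n U v0) = (t + (2 * n)%:R) *: iter n U v0.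
Proof.
elim: n => [|n IH]; first by rewrite muln0 addr0.
have /eqP := HU (iter n U v0); rewrite IH linearZ_LR /= subr_eq => /eqP ->.
by rewrite -scalerDl mulnS natrD addrCA.
Qed.

(** Induction through D U = U D + H: the scalars add up as n(t + n - 1) + (t + 2n) = (n + 1)(t +
    n). *)
Lemma lowering_iter n :
  D (iter n U v0) = (n%:R * (t + n%:R - 1)) *: iter n.-1 U v0.
Proof.
elim: n => [|n IH]; first by rewrite mul0r scale0r.
have /eqP := DU (iter n U v0).
rewrite weight_iter IH linearZ_LR /= subr_eq => /eqP ->.
(* At n = 0 the truncated predecessor makes the two vectors differ, but the scalar vanishes. *)
have -> : (n%:R * (t + n%:R - 1)) *: U (iter n.-1 U v0)
        = (n%:R * (t + n%:R - 1)) *: iter n U v0.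
  by case: n {IH} => [|n] //; rewrite !mul0r !scale0r.
rewrite -scalerDl; congr (_ *: _).
by rewrite -[n.+1]addn1 natrD natrM; ring.
Qed.

Lemma iter_lowering_iter n :
  iter n D (iter n U v0) = (n`!%:R * \prod_(i < n) (t + i%:R)) *: v0.
Proof.
elim: n => [|n IH]; first by rewrite big_ord0 mulr1 scale1r.
have iterDZ c v : iter n D (c *: v) = c *: iter n D v.
  by elim: n {IH} => //= n ->; rewrite linearZ_LR.
rewrite iterSr lowering_iter iterDZ IH scalerA; congr (_ *: _).
by rewrite big_ord_recr /= factS natrM -[n.+1]addn1 natrD; ring.
Qed.

End LowestWeightVector.

(** * Matrix coefficients of Kerov's operators and the closed form of the measure *)

Section Kerov.
Context {R : realType} {d : Order.disp_t} {P : porderType d}.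
Variables (kappa : ideal P -> ideal P -> R) (q : P -> R[i]).
Variables (U D H : {linear ell2fin R P -> ell2fin R P}).
Hypothesis finite_level : forall n, finite_set (level P n).
Hypothesis UDH : kerov_triplet kappa q U D H.
Implicit Types (f : ell2fin R P) (lam mu nu : ideal P).

Local Notation e0 := (evec ideal0 : ell2fin R P).
Local Notation t := (kerov_param H).
Local Notation edge := (edge kappa q).
Local Notation weight := (weight kappa q).

Lemma U_evec_coef lam nu : (U (evec lam))@_nu = edge lam nu.
Proof.
rewrite (kerovU UDH) mcoeff_fsum_evec; last exact: finite_covers.
by rewrite /edge mem_setE.
Qed.

Lemma D_evec_coef mu lam : (D (evec lam))@_mu = edge mu lam.
Proof.
rewrite (kerovD UDH) mcoeff_fsum_evec; last exact: finite_covered.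
by rewrite /edge mem_setE.
Qed.

Lemma D_coef n f lam : level P n lam ->
  (D f)@_lam = \sum_(nu \in level P n.+1) f@_nu * edge lam nu.
Proof.
move=> llam; rewrite (@mcoeff_linear _ _ _ D f lam (level P n.+1)).
  by apply: eq_fsbigr => nu _; rewrite D_evec_coef.
move=> nu lnu; rewrite D_evec_coef /edge; case: ifP; rewrite ?mulr0 // => cov.
by case: lnu; exact: level_covers cov llam.
Qed.

(** [U] moves up exactly one level, so its iterates on the vacuum are supported on one level, where
    the coefficients obey the recursion of [weight]. *)
Lemma iterU_coef n lam :
  (iter n U e0)@_lam = if #|` lam | == n then weight lam else 0.
Proof.
elim: n lam => [|n IH] nu.
  rewrite mcoeff_evec; case: eqVneq => [<-|ne]; first by rewrite cardfs0 weight0.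
  case: eqP => // c0; have : level P 0 nu by [].
  by rewrite level0 => /= e; rewrite e eqxx in ne.
rewrite iterS (@mcoeff_linear _ _ _ U _ nu (level P n)); last first.
  by move=> mu; rewrite IH /level /= => /eqP/negPf ->; rewrite mul0r.
under eq_fsbigr => mu do rewrite U_evec_coef IH.
case: eqP => lnu.
  rewrite (weight_rec kappa q finite_level lnu); apply: eq_fsbigr => mu.
  by rewrite inE => lmu; rewrite lmu eqxx.
apply: fsbig1 => mu lmu; rewrite /edge.
have [cov|_] := boolP (covers mu nu); last by rewrite mulr0.
by case: lnu; exact: (level_covers cov lmu).
Qed.

(** Stated for every [f] so that the innermost [D] can be peeled off in the induction; exchanging
    the two level sums then produces the recursion of [weight]. It serves both for a basis vector
    and for the iterates of [U] on the vacuum. *)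
Lemma iterD_coef0 n f :
  (iter n D f)@_ideal0 = \sum_(lam \in level P n) f@_lam * weight lam.
Proof.
elim: n f => [|n IH] f; first by rewrite level0 fsbig_set1 weight0 mulr1.
rewrite iterSr IH.
under eq_fsbigr => lam do [rewrite inE => llam;
  rewrite (D_coef _ llam) mulr_fsuml].
rewrite exchange_fsbig //; apply: eq_fsbigr => nu; rewrite inE => lnu.
rewrite (weight_rec kappa q finite_level lnu) mulr_fsumr.
by apply: eq_fsbigr => lam _; rewrite -mulrA [weight _ * _]mulrC.
Qed.

Lemma H_e0 : H e0 = t *: e0.
Proof.
have [h hH] := kerovH UDH.
suff -> : t = h #|` (ideal0 : ideal P) | by exact: hH.
by rewrite /kerov_param inner_evec (hH ideal0) mcoeffZ_evec eqxx.
Qed.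

Lemma D_e0 : D e0 = 0.
Proof.
rewrite (kerovD UDH) fsbig1 // => mu /= /andP[_].
by rewrite cardfs0.
Qed.

Lemma D_iterU n :
  D (iter n U e0) = (n%:R * (t + n%:R - 1)) *: iter n.-1 U e0.
Proof. exact: (lowering_iter (kerovHU UDH) (kerovDU UDH) H_e0 D_e0). Qed.

Lemma iterD_iterU n : iter n D (iter n U e0) = (n`!%:R * rising t n) *: e0.
Proof.
exact: (iter_lowering_iter (kerovHU UDH) (kerovDU UDH) H_e0 D_e0). Qed.

Lemma kerov_measureE n lam : level P n lam ->
  kerov_measure U D H n lam = weight lam ^+ 2 / (n`!%:R * rising t n).
Proof.
move=> llam; rewrite /kerov_measure expr2; congr (_ * _ / _).
  by rewrite inner_evec iterU_coef llam eqxx.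
rewrite inner_evec iterD_coef0 (fsbigE [:: lam]) //=; first last.
- by move=> mu _; rewrite inE mcoeff_evec eq_sym => /negPf ->; rewrite mul0r.
- by move=> mu /=; rewrite inE => /eqP ->.
by rewrite big_mkcond big_seq1 mem_set // mcoeff_evec eqxx mul1r.
Qed.

(** * Total mass and coherence for nondegenerate t *)

Hypothesis t_nondeg : forall k : nat, t <> - k%:R.

Lemma rising_neq0 n : n`!%:R * rising t n != 0.
Proof.
rewrite mulf_neq0 ?pnatr_eq0 -?lt0n ?fact_gt0 //.
by apply/prodf_neq0 => i _; rewrite addr_eq0; apply/eqP.
Qed.

Lemma kerov_measure_sum n :
  \sum_(lam \in level P n) kerov_measure U D H n lam = 1.
Proof.
under eq_fsbigr => lam do [rewrite inE => llam; rewrite (kerov_measureE llam)].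
rewrite -mulr_fsuml -[RHS](divff (rising_neq0 n)); congr (_ / _).
(* The vacuum coefficient of D^n U^n e_0 is the sum of the squared weights. *)
have := congr1 (fun f : ell2fin R P => f@_ideal0) (iterD_iterU n).
rewrite mcoeffZ_evec eqxx mulr1n iterD_coef0 => <-.
apply: eq_fsbigr => lam; rewrite inE => llam.
by rewrite iterU_coef llam eqxx expr2.
Qed.

Hypothesis kappa_gt0 : positive_multiplicity kappa.

Lemma wdim_ge0 lam : 0 <= wdim kappa lam.
Proof.
apply: fsumr_ge0 => c [pc _].
elim: c ideal0 pc => [|x c IH] y /=; first by rewrite big_nil.
by case/andP=> cov pc; rewrite big_cons mulr_ge0 ?IH // ltW ?kappa_gt0.
Qed.

(** A vanishing sum of nonnegative terms has vanishing terms, and [kappa lam nu] is positive. This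
    settles the case of a zero denominator in the coherence relation. *)
Lemma wdim_covers_eq0 lam nu : covers lam nu ->
  wdim kappa nu = 0 -> wdim kappa lam = 0.
Proof.
move=> cov; have lnu : level P #|` lam |.+1 nu by exact: level_covers cov _.
rewrite (wdim_rec kappa finite_level lnu) => /pfsumr_eq0.
move=> /(_ (finite_level _) _ lam erefl); rewrite cov => nu0.
have /eqP : wdim kappa lam * kappa lam nu = 0.
  by apply: nu0 => mu _; case: ifP => // ?; rewrite mulr_ge0 ?wdim_ge0 ?ltW ?kappa_gt0.
by rewrite mulf_eq0 (gt_eqF (kappa_gt0 cov)) orbF => /eqP.
Qed.

Lemma kerov_measure_coherent n lam : level P n lam ->
  \sum_(nu \in [set nu | covers lam nu])
    kerov_measure U D H n.+1 nu
      * (kappa lam nu * wdim kappa lam / wdim kappa nu)%:C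
  = kerov_measure U D H n lam.
Proof.
move=> llam; set N := n.+1`!%:R * rising t n.+1.
have coef : \sum_(nu \in level P n.+1) weight nu * edge lam nu
          = n.+1%:R * (t + n%:R) * weight lam.
  have := congr1 (fun f : ell2fin R P => f@_lam) (D_iterU n.+1).
  rewrite (D_coef _ llam) /= mcoeffZ iterU_coef llam eqxx => e.
  transitivity (n.+1%:R * (t + n.+1%:R - 1) * weight lam).
    rewrite -e; apply: eq_fsbigr => nu; rewrite inE => lnu.
    by rewrite (iterU_coef n.+1) lnu eqxx.
  by rewrite -[n.+1]addn1 natrD; ring.
(* One factor w(nu) of the squared weight, times kappa dim(lam) / dim(nu), equals w(lam) times the
   edge from [lam] to [nu]. *)
transitivity (weight lam / N * \sum_(nu \in level P n.+1) weight nu * edge lam nu).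
  rewrite mulr_fsumr -(fsbig_widen [set nu | covers lam nu] (level P n.+1));
    first last.
  - by move=> nu [_ /= ncov]; rewrite /edge; case: ifP => // _; rewrite !mulr0.
  - by move=> nu /= cov; exact: level_covers cov llam.
  apply: eq_fsbigr => nu; rewrite inE /= => cov.
  rewrite (kerov_measureE (level_covers cov llam)) -/N /edge cov /weight.
  rewrite (prod_covers q cov) !rmorphM /= fmorphV /=.
  have [dnu0|dnu0] := eqVneq (wdim kappa nu) 0.
    by rewrite dnu0 (wdim_covers_eq0 cov dnu0) /= !(mulr0, mul0r).
  have dnu0C : (wdim kappa nu)%:C != 0 by rewrite fmorph_eq0.
  by field; rewrite rising_neq0.
rewrite coef (kerov_measureE llam).
(* The quotient of consecutive normalisations is exactly the scalar in [coef], so it cancels. *)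
have NE : N = n.+1%:R * (t + n%:R) * (n`!%:R * rising t n).
  by rewrite /N /rising big_ord_recr /= factS natrM; ring.
have := rising_neq0 n.+1; rewrite -/N NE mulf_eq0 negb_or => /andP[c0 r0].
move: (_ * (t + _)) (_ * rising t n) c0 r0 => c r c0 r0.
by field; rewrite c0 r0.
Qed.

End Kerov.

Theorem theorem4p5 (R : realType) (d : Order.disp_t) (P : porderType d)
  (finite_below : forall x : P, exists lam : ideal P, x \in (lam : {fset P}))
  (finite_level : forall n : nat, finite_set (level P n))
  (extendable : forall lam : ideal P, exists nu : ideal P, covers lam nu)
  (kappa : ideal P -> ideal P -> R)
  (kappa_gt0 : positive_multiplicity kappa)
  (kappa_dual : UD_self_dual kappa)
  (q : P -> R[i]) (U D H : {linear ell2fin R P -> ell2fin R P})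
  (UDH : kerov_triplet kappa q U D H)
  (t_nondeg : forall k : nat, kerov_param H <> - k%:R) :
  (forall (n : nat) (lam : ideal P), level P n lam ->
     kerov_measure U D H n lam =
       ((wdim kappa lam)%:C) ^+ 2 / (n`!%:R * rising (kerov_param H) n)
       * \prod_(x <- (lam : {fset P})) q x ^+ 2)
  /\ coherent_system kappa (kerov_measure U D H).
Proof.
split=> [n lam llam|].
  rewrite (kerov_measureE finite_level UDH llam) /weight exprMn prodrXl.
  by rewrite mulrAC.
split; first exact: kerov_measure_sum finite_level UDH t_nondeg.
exact: (kerov_measure_coherent finite_level UDH t_nondeg kappa_gt0).
Qed.
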